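(* Let $0<\tau<1$ be a real number. Any encoding able to count, for every range $[i,j]$ with $1\le i\le j\le n$, the number of distinct $\tau$-majorities in $A[i,j]$ must use $\Omega(n\log(1/\tau))$ bits (in the worst case over arrays $A[1,n]$).
   Context: Let $A[1,n]$ be an array of arbitrary elements. For $0<\tau<1$, a $\tau$-majority of a range $A[i,j]$ is any element that occurs more than $\tau(j-i+1)$ times in $A[i,j]$. An encoding is a data structure built from $A$ that answers the queries without accessing $A$; its size is measured as the number of bits it occupies, i.e. the encoding is a map from arrays of length $n$ to bit strings such that the query answers (here, the number of distinct $\tau$-majorities in every range $A[i,j]$) are determined by the bit string alone. The bound means: there is a constant $c>0$ such that, for such encodings, some input array of length $n$ requires at least $c\, n\log(1/\tau)$ bits. *)

(* Defs.v *)
From mathcomp Require Import all_boot all_order all_algebra.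
From mathcomp Require Import reals exp.

Set Implicit Arguments.
Unset Strict Implicit.
Unset Printing Implicit Defensive.

Import Order.TTheory GRing.Theory Num.Theory.

Local Open Scope ring_scope.

Definition log2 (R : realType) (x : R) : R := ln x / ln 2.

(* A[i,j] with 1-based inclusive bounds, meaningful for 1 <= i <= j <= size A *)
Definition subarray (T : Type) (A : seq T) (i j : nat) : seq T :=
  take (j - i).+1 (drop i.-1 A).

Definition is_majority (R : realType) (T : eqType) (tau : R) (A : seq T)
    (i j : nat) (x : T) : bool :=
  tau * (j - i + 1)%N%:R < (count_mem x (subarray A i j))%:R.

(* For tau > 0 a tau-majority occurs at least once in the range, so it is
   enough to look among the distinct elements of the range. *)
Definition num_majorities (R : realType) (T : eqType) (tau : R) (A : seq T)
    (i j : nat) : nat :=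
  count (is_majority tau A i j) (undup (subarray A i j)).

(* The query procedure sees only the bit string; it may depend on n, tau and
   the encoding scheme, since it is chosen after them. Code words may have
   different lengths and need not be prefix-free. *)
Definition majority_counting_encoding (R : realType) (T : eqType) (tau : R)
    (n : nat) (enc : n.-tuple T -> bitseq) : Prop :=
  exists query : bitseq -> nat -> nat -> nat,
    forall (A : n.-tuple T) (i j : nat), (1 <= i)%N -> (i <= j)%N -> (j <= n)%N ->
      query (enc A) i j = num_majorities tau A i j.

(* Main.v *)
Require Import Defs.
From mathcomp Require Import all_boot all_order all_algebra.
From mathcomp Require Import reals exp.
From mathcomp Require Import zify lra.

Import Order.TTheory GRing.Theory Num.Theory.

Set Implicit Arguments.
Unset Strict Implicit.
Unset Printing Implicit Defensive.

(** On a range of length less than 1/tau every element that occurs is a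
    tau-majority, so the queries count the distinct elements of the range, and
    these counts reveal which pairs of positions less than 1/tau apart hold
    equal elements. With 2k < 1/tau, cut the array into blocks of length 2k whose
    first halves list k fixed distinct elements: the second halves, arbitrary
    words over these elements, are then determined by the answers. With k a
    power of two within a constant factor of 1/tau this gives about
    (n/2) log2 k bits. For 1/tau <= 4, blocks of length 2 holding either equal or
    distinct elements give n/2 bits. *)

Lemma size_undup_cons (T : eqType) (x : T) (s : seq T) :
  size (undup (x :: s)) = (x \notin s) + size (undup s).
Proof. by rewrite /=; case: (x \in s). Qed.

(** Prepending a letter to a window raises its number of distinct elements exactly when the letter
    is new there. The counts thus decide whether the letter at [p] recurs within the next [l]
    positions, and induction on the distance [d] locates the recurrences. *)
Lemma eq_pattern_of_size_undup (T : eqType) (x0 : T) (n M : nat)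
    (A B : seq T) :
  size A = n -> size B = n ->
  (forall p l, p + l <= n -> l <= M ->
     size (undup (take l (drop p A))) = size (undup (take l (drop p B)))) ->
  forall d p, p + d < n -> d < M ->
    (nth x0 A p == nth x0 A (p + d)) = (nth x0 B p == nth x0 B (p + d)).
Proof.
move=> sA sB H.
have mem_pattern p l : p + l < n -> l < M ->
    (nth x0 A p \in take l (drop p.+1 A)) =
    (nth x0 B p \in take l (drop p.+1 B)).
  move=> pl lM; have := H p l.+1; rewrite addnS => /(_ pl lM).
  rewrite (@drop_nth _ x0 p A) ?sA; last lia.
  rewrite (@drop_nth _ x0 p B) ?sB; last lia.
  rewrite ![take l.+1 _]/= !size_undup_cons (H p.+1 l); lia.
elim/ltn_ind=> -[|d] IH p pd dM; first by rewrite addn0 !eqxx.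
have eqd := mem_pattern p d ltac:(lia) ltac:(lia).
have := mem_pattern p d.+1 pd dM.
rewrite !(@take_nth _ x0 d) ?size_drop; try lia.
rewrite !nth_drop !mem_rcons !in_cons -eqd addSnnS.
(* If the letter at [p] already recurs earlier, at [p.+1 + r], membership says nothing about the new
   end of the window. By induction [B] has the same recurrence, so [p] may be replaced by
   [p.+1 + r], which is closer to the end. *)
have [Ad _|_] := boolP (_ \in _); last by rewrite !orbF.
have /(nthP x0) [r] := Ad.
rewrite size_take size_drop => rd.
have {}rd : r < d by move: rd; case: ifP; lia.
rewrite nth_take // nth_drop => /esym/eqP Apr.
have Bpr : nth x0 B p == nth x0 B (p.+1 + r).
  by rewrite addSnnS -IH -?addSnnS //; lia.
rewrite (eqP Apr) (eqP Bpr).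
have -> : p + d.+1 = p.+1 + r + (d - r) by lia.
by apply: IH; lia.
Qed.

(** Split by first bit: at most one empty word, and two classes whose tails are shorter than
    [k - 1], so at most [1 + 2 * (2 ^ (k - 1) - 1)] words. No prefix-freeness is assumed. *)
Lemma card_short_bitseq (k : nat) (I : finType) (g : I -> bitseq) :
  injective g -> (forall x, size (g x) < k) -> #|I| < 2 ^ k.
Proof.
elim: k I g => [|k IH] I g g_inj g_short.
  have I0 : #|I| = 0 by apply: eq_card0 => x; have := g_short x.
  by rewrite I0.
pose J (b : bool) := {x : I | ohead (g x) == Some b}.
have J_bound b : #|{: J b}| < 2 ^ k.
  apply: (IH _ (fun x : J b => behead (g (val x)))) => [[x xP] [y yP] /= e|x].
    apply/val_inj/g_inj => /=.
    by move: xP yP e; case: (g x) => // ? ?; case: (g y) => // ? ? /= /eqP[->] /eqP[->] ->.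
  have := g_short (val x); have := valP x => /=.
  by case: (g _).
have nil_bound : #|[pred x | g x == [::]]| <= 1.
  apply/card_le1_eqP => x y; rewrite !inE => /eqP gx /eqP gy.
  by apply: g_inj; rewrite gx gy.
have := J_bound true; have := J_bound false; rewrite !card_sig.
have -> : #|I| = #|[pred x | g x == [::]]| +
    (#|[pred x | ohead (g x) == Some true]| +
     #|[pred x | ohead (g x) == Some false]|).
  rewrite -!sum1_card [LHS](bigID [pred x | g x == [::]]) /=; congr (_ + _).
  rewrite (bigID [pred x | ohead (g x) == Some true]) /=.
  by congr (_ + _); apply: eq_bigl => x; rewrite ?inE; case: (g x) => // -[].
move: nil_bound; rewrite expnS; lia.
Qed.

Lemma exists_long_code (T : Type) (I : finType) (g : I -> T)
    (enc : T -> bitseq) (k : nat) :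
  injective (enc \o g) -> 2 ^ k <= #|I| -> exists A, k <= size (enc A).
Proof.
move=> inj le.
have [/existsP [x]|/existsPn H] := boolP [exists x, k <= size (enc (g x))].
  by exists (g x).
have := @card_short_bitseq k I _ inj; rewrite ltnNge le => /(_ _)/notF [] x.
by rewrite ltnNge; exact: H.
Qed.

Section EncodingBounds.
Variables (R : realType) (tau : R) (n : nat) (T : eqType).
Variable enc : n.-tuple T -> bitseq.
Hypothesis encP : majority_counting_encoding tau enc.
Hypothesis tau_gt0 : (0 < tau)%R.

Lemma eq_num_majorities (A B : n.-tuple T) (i j : nat) :
  enc A = enc B -> 1 <= i -> i <= j -> j <= n ->
  num_majorities tau A i j = num_majorities tau B i j.
Proof. by case: encP => q qP eAB *; rewrite -!qP // eAB. Qed.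

Lemma num_majorities_short (A : seq T) (p l : nat) :
  (tau * l.+1%:R < 1)%R ->
  num_majorities tau A p.+1 (p + l.+1) =
  size (undup (take l.+1 (drop p A))).
Proof.
move=> short; rewrite /num_majorities /subarray /=.
have -> : (p + l.+1 - p.+1).+1 = l.+1 by lia.
rewrite -[RHS]count_predT; apply: eq_in_count => x.
rewrite mem_undup -has_pred1 has_count => x_in.
rewrite /is_majority /subarray /=.
have -> : (p + l.+1 - p.+1).+1 = l.+1 by lia.
have -> : p + l.+1 - p.+1 + 1 = l.+1 by lia.
by apply: lt_le_trans short _; rewrite ler1n.
Qed.

Lemma eq_pattern_of_enc (x0 : T) (M : nat) (A B : n.-tuple T) :
  (tau * M%:R < 1)%R -> enc A = enc B ->
  forall d p, p + d < n -> d < M ->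
    (nth x0 A p == nth x0 A (p + d)) = (nth x0 B p == nth x0 B (p + d)).
Proof.
move=> tauM eAB; apply: eq_pattern_of_size_undup; rewrite ?size_tuple //.
move=> p [|l] pl lM; first by rewrite !take0.
have short : (tau * l.+1%:R < 1)%R.
  by apply: le_lt_trans tauM; rewrite ler_pM2l // ler_nat.
by rewrite -!num_majorities_short //; apply: eq_num_majorities => //; lia.
Qed.

Lemma block_lower_bound (s : n.-tuple T) (k b : nat) :
  uniq s -> 0 < k -> 0 < b -> b * (2 * k) <= n -> (tau * (2 * k)%:R < 1)%R ->
  forall e, 2 ^ e <= k -> exists A, e * (b * k) <= size (enc A).
Proof.
move=> s_uniq k_gt0 b_gt0 bk_le short e e_le.
have n_gt0 : 0 < n by nia.
have x0 : T := tnth s (Ordinal n_gt0).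
pose i0 : 'I_b := Ordinal b_gt0; pose j0 : 'I_k := Ordinal k_gt0.
(* The default [i0] fills any positions beyond the [b] blocks. *)
pose val_at (F : {ffun 'I_b * 'I_k -> 'I_k}) (x : nat) : nat :=
  let r := x %% (2 * k) in
  if r < k then r
  else F (insubd i0 (x %/ (2 * k)), insubd j0 (r - k)).
pose g F : n.-tuple T := [tuple nth x0 s (val_at F i) | i < n].
have nth_g F x : x < n -> nth x0 (g F) x = nth x0 s (val_at F x).
  by move=> xn; rewrite -[x]/(val (Ordinal xn)) -tnth_nth tnth_mktuple.
apply: (@exists_long_code _ _ g).
  move=> F G /= eFG; apply/ffunP => -[t j].
  have tb := ltn_ord t; have jk := ltn_ord j; have Fk := ltn_ord (F (t, j)).
  (* Position [p], in the first half of block [t], carries letter [F (t, j)] in both arrays. At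
     distance [k + j - F (t, j) < 2 * k] lies entry [j] of the second half. The two agree in [g F],
     hence in [g G], which forces [G (t, j) = F (t, j)]. *)
  pose p := t * (2 * k) + F (t, j).
  have pE (H : {ffun 'I_b * 'I_k -> 'I_k}) : val_at H p = F (t, j).
    by rewrite /val_at /p modnMDl modn_small ?Fk //; lia.
  have qE (H : {ffun 'I_b * 'I_k -> 'I_k}) :
      val_at H (p + (k + j - F (t, j))) = H (t, j).
    have -> : p + (k + j - F (t, j)) = t * (2 * k) + (k + j) by rewrite /p; lia.
    rewrite /val_at modnMDl modn_small; last lia.
    rewrite ltnNge leq_addr /= divnMDl; last lia.
    by rewrite divn_small ?addn0 ?addKn ?valKd //; lia.
  have tk : t.+1 * (2 * k) <= b * (2 * k) by rewrite leq_mul2r tb orbT.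
  have q_lt : p + (k + j - F (t, j)) < n.
    by apply: leq_trans bk_le; rewrite mulSn in tk; rewrite /p; lia.
  have := eq_pattern_of_enc x0 short eFG q_lt ltac:(lia).
  have kn : k <= n by nia.
  rewrite !nth_g ?pE ?qE ?eqxx //; try lia.
  rewrite nth_uniq ?size_tuple ?(leq_trans (ltn_ord _) kn) //.
  by move/esym/eqP/val_inj.
rewrite card_ffun card_prod !card_ord expnM leq_exp2r //.
by rewrite muln_gt0 b_gt0.
Qed.

(** Two equal elements give one majority because [tau < 1]; two distinct ones give 2 or 0 according
    to whether [2 * tau < 1], never 1. Each aligned pair thus reveals one bit. *)
Lemma pair_lower_bound (s : n.-tuple T) :
  uniq s -> (tau < 1)%R -> 1 < n -> exists A, n./2 <= size (enc A).
Proof.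
move=> s_uniq tau_lt1 n_gt1.
have x0 : T := tnth s (Ordinal (ltnW n_gt1)).
have half_gt0 : 0 < n./2 by lia.
pose i0 : 'I_(n./2) := Ordinal half_gt0.
pose val_at (F : {ffun 'I_(n./2) -> bool}) (x : nat) : nat :=
  odd x && F (insubd i0 (x./2)).
pose g F : n.-tuple T := [tuple nth x0 s (val_at F i) | i < n].
have nth_g F x : x < n -> nth x0 (g F) x = nth x0 s (val_at F x).
  by move=> xn; rewrite -[x]/(val (Ordinal xn)) -tnth_nth tnth_mktuple.
have num_g F (t : 'I_(n./2)) :
    num_majorities tau (g F) t.*2.+1 t.*2.+2 =
    if F t then 2 * (2 * tau < 1)%R else 1.
  have tn := ltn_ord t.
  pose w := [:: nth x0 s 0; nth x0 s (F t)].
  have -> : num_majorities tau (g F) t.*2.+1 t.*2.+2 =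
      count (fun x => tau * 2 < (count_mem x w)%:R)%R (undup w).
    have subE : subarray (g F) t.*2.+1 t.*2.+2 = w.
      rewrite /subarray subSnn succnK.
      rewrite (drop_nth x0) ?size_tuple; last lia.
      rewrite (drop_nth x0) ?size_tuple; last lia.
      rewrite !nth_g; try lia.
      by rewrite [take _ _]/= take0 /val_at /= odd_double /= uphalf_double valKd.
    rewrite /num_majorities subE; apply: eq_count => x.
    by rewrite /is_majority subE subSnn.
  rewrite /w; case: (F t) => /=; rewrite inE; last first.
    by rewrite eqxx /= eqxx /=; have -> : (tau * 2 < 2)%R by lra.
  have /negbTE s01 : nth x0 s 0 != nth x0 s 1.
    by rewrite nth_uniq ?size_tuple // ltnW.
  rewrite s01 /= !eqxx s01 eq_sym s01 /=.
  by rewrite [(tau * _)%R]mulrC; case: (_ < _)%R.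
apply: (@exists_long_code _ _ g); last by rewrite card_ffun card_bool card_ord.
move=> F G /= eFG; apply/ffunP => t; have tn := ltn_ord t.
have := @eq_num_majorities _ _ t.*2.+1 t.*2.+2 eFG; rewrite !num_g.
move=> /(_ ltac:(lia) ltac:(lia) ltac:(lia)).
by case: (F t); case: (G t) => //; case: (2 * tau < 1)%R.
Qed.

End EncodingBounds.

Local Open Scope ring_scope.

Lemma log2_le_of_le_exp (R : realType) (x : R) (m : nat) :
  0 < x -> x <= (2 ^ m)%N%:R -> log2 x <= m%:R.
Proof.
move=> x_gt0 le; rewrite /log2 ler_pdivrMr; last by rewrite ln_gt0 // ltr1n.
rewrite mulr_natl -lnXn // ler_ln ?posrE ?exprn_gt0 //.
by rewrite -natrX.
Qed.

Theorem theorem1 (R : realType) :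
  exists c : R, 0 < c /\
    forall (tau : R) (n : nat) (T : eqType) (enc : n.-tuple T -> bitseq),
      0 < tau -> tau < 1 ->
      1 / tau <= n%:R ->
      (exists s : n.-tuple T, uniq s) ->
      majority_counting_encoding tau enc ->
      exists A : n.-tuple T,
        c * n%:R * log2 (1 / tau) <= (size (enc A))%:R.
Proof.
(* 12 is 4 times 3: below, [n <= 4 * (b * k)] and [e + 3 <= 3 * (e + 1)]. *)
exists (1 / 12); split; first lra.
move=> tau n T enc tau_gt0 tau_lt1 tau_n [s s_uniq] encP.
have inv_gt0 : 0 < 1 / tau by rewrite divr_gt0.
have inv_gt1 : 1 < 1 / tau by rewrite ltr_pdivlMr // mul1r.
have n_gt1 : (1 < n)%N by rewrite -(ltr1n R); apply: lt_le_trans tau_n.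
have reduce (l m : nat) : 1 / tau <= (2 ^ l)%N%:R -> (n * l <= 12 * m)%N ->
    1 / 12 * n%:R * log2 (1 / tau) <= m%:R.
  move=> /(log2_le_of_le_exp inv_gt0) log_le; rewrite -(ler_nat R) !natrM => nl.
  have : n%:R * log2 (1 / tau) <= n%:R * l%:R by rewrite ler_wpM2l.
  by rewrite -mulrA; lra.
have [tau_large|tau_small] := leP (1 / tau) (2 ^ 2)%N%:R.
  have [A A_size] := pair_lower_bound encP tau_gt0 s_uniq tau_lt1 n_gt1.
  exists A; apply: le_trans (reduce 2%N n./2 tau_large _) _; last first.
    by rewrite ler_nat.
  lia.
have ex_e : exists e, 1 / tau <= (2 ^ e.+2)%N%:R.
  exists n; apply: le_trans tau_n _; rewrite ler_nat ltnW //.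
  by apply: ltn_trans (ltn_expl n (ltnSn 1)) _; rewrite ltn_exp2l //; lia.
(* Minimality brackets [1 / tau] between the block length [2 ^ e.+2], strictly, and its double. As
   [1 / tau <= n], at least one block fits. *)
case: (ex_minnP ex_e) => -[|e] e_le e_min; first by move: e_le; rewrite leNgt tau_small.
have e_gt : (2 ^ e.+2)%N%:R < 1 / tau.
  by rewrite ltNge; apply/negP => /e_min; rewrite ltnn.
have blk_n : (2 ^ e.+2 < n)%N by rewrite -(ltr_nat R); apply: lt_le_trans tau_n.
have k_gt0 : (0 < 2 ^ e.+1)%N by rewrite expn_gt0.
have blkE : (2 ^ e.+2 = 2 * 2 ^ e.+1)%N by rewrite -expnS.
have b_gt0 : (0 < n %/ 2 ^ e.+2)%N by rewrite divn_gt0 ?expn_gt0 // ltnW.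
have short : tau * (2 * 2 ^ e.+1)%N%:R < 1.
  by rewrite -blkE mulrC -ltr_pdivlMr.
have := block_lower_bound encP tau_gt0 s_uniq k_gt0 b_gt0 _ short (leqnn _).
rewrite -blkE => /(_ (leq_trunc_div _ _)) [A A_size].
exists A; apply: le_trans (reduce _ _ e_le _) _; last first.
  by rewrite ler_nat; exact: A_size.
have n_lt : (n < (n %/ 2 ^ e.+2).+1 * 2 ^ e.+2)%N by rewrite ltn_ceil ?expn_gt0.
move: n_lt b_gt0; rewrite {2}blkE; move: (n %/ _)%N (2 ^ e.+1)%N => b k n_lt b_gt0.
(* The incomplete last block at most doubles the length, since [b >= 1]. *)
have n_le : (n <= 4 * (b * k))%N by nia.
have := leq_mul n_le (leqnn e.+3); nia.
Qed.
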